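(* Let $\Omega\subset\mathbb{R}^N$ ($N\ge 1$) be a bounded domain with smooth boundary, let $\alpha,\beta>0$, and let $\rho\in C^{0,\gamma}(\Omega)$ ($0<\gamma<1$) with $\rho\ge 0$, $\rho\not\equiv 0$. Let $p,q,r,s>0$ be such that one of the following conditions holds: (i) $s>1$ and $2q\ge (s+1)(p+2)$; (ii) $s=1$ and $q>p+2$; (iii) $0<s<1$ and $q\ge p+2$. Then the system $$\begin{cases}\Delta u-\alpha u+\dfrac{u^p}{v^q}+\rho(x)=0 & \text{in }\Omega,\\[2mm] \Delta v-\beta v+\dfrac{u^r}{v^s}=0 & \text{in }\Omega,\\[1mm] u=0,\ v=0 & \text{on }\partial\Omega\end{cases}$$ has no positive classical solutions.
   Context: A positive classical solution is a pair $(u,v)$ with $u,v\in C^2(\Omega)\cap C(\overline\Omega)$, $u,v>0$ in $\Omega$, satisfying the system pointwise. $C^{0,\gamma}(\Omega)$ denotes functions that are Hölder continuous on $\Omega$ with exponent $\gamma$ (hence extending continuously to $\overline\Omega$). *)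

(* Defs.v *)
From HB Require Import structures.
From mathcomp Require Import all_boot all_order all_algebra.
From mathcomp Require Import all_classical all_reals all_analysis.

Set Implicit Arguments.
Unset Strict Implicit.
Unset Printing Implicit Defensive.

Import Order.TTheory GRing.Theory Num.Theory.
Import numFieldNormedType.Exports.

Local Open Scope classical_set_scope.
Local Open Scope ring_scope.

(* MathComp-Analysis throughout. The library norm on 'rV[R]_N is the sup norm;
   it is used only for its topology and for boundedness. *)

(* For open U. The values of f outside U are irrelevant, the partial
   derivatives at a point of U depending only on f near that point. *)
Fixpoint Ck_on (R : realType) (N k : nat) (U : set 'rV[R]_N)
    (f : 'rV[R]_N -> R) : Prop :=
  if k is k'.+1 then
    {in U, continuous f} /\
    forall i : 'I_N, (forall x, U x -> derivable f x 'e_i) /\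
                     Ck_on k' U (fun x => 'D_'e_i f x)
  else {in U, continuous f}.

Definition smooth_on (R : realType) (N : nat) (U : set 'rV[R]_N)
    (f : 'rV[R]_N -> R) : Prop :=
  forall k : nat, Ck_on k U f.

Definition laplacian (R : realType) (N : nat) (f : 'rV[R]_N -> R)
    (x : 'rV[R]_N) : R :=
  \sum_(i < N) 'D_'e_i (fun y => 'D_'e_i f y) x.

Definition eucl_norm (R : realType) (N : nat) (x : 'rV[R]_N) : R :=
  Num.sqrt (\sum_(i < N) x ord0 i ^+ 2).

Definition holder_on (R : realType) (N : nat) (gamma : R) (U : set 'rV[R]_N)
    (f : 'rV[R]_N -> R) : Prop :=
  exists C : R, forall x y, U x -> U y ->
    `|f x - f y| <= C * eucl_norm (x - y) `^ gamma.

Definition boundary (T : topologicalType) (A : set T) : set T :=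
  closure A `\` interior A.

Definition bounded_domain (R : realType) (N : nat) (Omega : set 'rV[R]_N) :
    Prop :=
  [/\ open Omega, connected Omega, Omega !=set0 & bounded_set Omega].

(* The boundary is C^infinity: near each boundary point, Omega is the
   sublevel set [phi < 0] of a C^infinity function with non-vanishing gradient
   (so Omega lies locally on one side of its boundary [phi = 0]). *)
Definition smooth_boundary (R : realType) (N : nat) (Omega : set 'rV[R]_N) :
    Prop :=
  forall x0, boundary Omega x0 ->
    exists (U : set 'rV[R]_N) (phi : 'rV[R]_N -> R),
      [/\ open U /\ U x0,
          smooth_on U phi,
          exists i : 'I_N, 'D_'e_i phi x0 != 0
        & forall x, U x -> (Omega x <-> phi x < 0)].

(* u and v are total functions; only their values on closure Omega matter. *)
Definition positive_classical_solution (R : realType) (N : nat)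
    (Omega : set 'rV[R]_N) (alpha beta p q r s : R) (rho : 'rV[R]_N -> R)
    (u v : 'rV[R]_N -> R) : Prop :=
  [/\ [/\ Ck_on 2 Omega u, {within closure Omega, continuous u},
          Ck_on 2 Omega v & {within closure Omega, continuous v}],
      forall x, Omega x -> 0 < u x /\ 0 < v x,
      forall x, Omega x ->
        laplacian u x - alpha * u x + u x `^ p / v x `^ q + rho x = 0,
      forall x, Omega x ->
        laplacian v x - beta * v x + u x `^ r / v x `^ s = 0
    & forall x, boundary Omega x -> u x = 0 /\ v x = 0].

(* Main.v *)
Require Import Defs.
From HB Require Import structures.
From mathcomp Require Import all_boot all_order all_algebra.
From mathcomp Require Import all_classical all_reals all_analysis.
From mathcomp Require Import ring lra.
Import Order.TTheory GRing.Theory Num.Theory.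
Import numFieldNormedType.Exports.
Local Open Scope classical_set_scope.
Local Open Scope ring_scope.

(** Let [x0] maximise a coordinate [x_i] over the closure of [Omega], with maximum [M].
    Since [Omega] lies in the half-space [x_i < M], comparing [v] with a concave
    function [W (M - x_i)] such that [W'' <= - E / W^s] gives
    [v^q <= C (M - x_i)^(p+2)].  Smoothness of the boundary provides a ball in [Omega]
    tangent at [x0]; there a Hopf barrier bounds [u] below by a multiple of the
    distance to the sphere.  Hence on a ball of radius comparable to [t] centred on
    the normal at distance [t] from [x0] one has [u^p / v^q >= c / t^2], and a
    paraboloid supported on that ball forces [u >= delta] at its centre with [delta]
    independent of [t].  This contradicts [u x0 = 0]. *)

Set Implicit Arguments.
Unset Strict Implicit.

(** * The maximum principle *)

(** The first derivative vanishes at the maximum. If [l > 0], then [f1] is positive just to the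
    right of [0], and the mean value theorem makes [f] exceed [f 0] there. *)
Lemma derive2_le0_at_max (R : realType) (f f1 : R -> R) (l e : R) :
  0 < e -> (forall t : R, `|t| < e -> is_derive t 1 f (f1 t)) ->
  is_derive (0 : R) 1 f1 l -> (forall t, `|t| < e -> f t <= f 0) -> l <= 0.
Proof.
move=> e0 df df1 fmax.
have in_e (t : R) : (t \in `](- e), e[%R) = (`|t| < e) by rewrite in_itv/= ltr_norml.
have f10 : f1 0 = 0.
  have H : is_derive (0 : R) 1 f 0.
    apply: (@derive1_at_max _ _ (- e) e).
    - lra.
    - by move=> t; rewrite in_e => /df [].
    - by rewrite in_e normr0.
    - by move=> t; rewrite in_e; exact: fmax.
  have [_ <-] : is_derive (0 : R) 1 f (f1 0) by apply: df; rewrite normr0.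
  by case: H.
rewrite leNgt; apply/negP => l0.
have /cvgrPdist_lt/(_ l l0) : (fun h : R => h^-1 *: ((f1 \o shift 0) (h *: 1) - f1 0)) @ 0^' --> l.
  by case: df1 => cf <-.
move=> [d /= d0 Hd].
pose m := Num.min (d / 2) (e / 2).
have m0 : 0 < m by rewrite lt_min !divr_gt0.
have md : m < d by rewrite gt_min; apply/orP; left; lra.
have me : m < e by rewrite gt_min; apply/orP; right; lra.
have f1_gt0 (t : R) : 0 < t -> t < d -> 0 < f1 t.
  move=> t0 td.
  have := Hd t; rewrite /= sub0r normrN gtr0_norm// => /(_ td).
  rewrite lt0r_neq0// => /(_ isT).
  rewrite f10 subr0 addr0 [_ *: 1]mulr1 ltr_distlC => /andP[H _].
  have : 0 < t^-1 * f1 t by move: H; rewrite subrr.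
  by rewrite pmulr_rgt0// invr_gt0.
have [c cm fE] : exists2 c, c \in `]0, m[%R & f m - f 0 = f1 c * (m - 0).
  apply: MVT => //.
    move=> x; rewrite in_itv/= => /andP[x0 xm]; apply: df.
    by rewrite gtr0_norm// (lt_trans xm).
  apply: derivable_within_continuous => x; rewrite in_itv/= => /andP[x0 xm].
  have [] // : is_derive x 1 f (f1 x).
  by apply: df; rewrite ger0_norm// (le_lt_trans xm).
move: cm; rewrite in_itv/= => /andP[c0 cm].
have : 0 < f m - f 0 by rewrite fE subr0 mulr_gt0// f1_gt0// (lt_trans cm).
by rewrite subr_gt0 ltNge fmax// gtr0_norm.
Qed.

Lemma is_derive_line (R : realType) (V : normedModType R) (f : V -> R)
    (x v : V) (t d : R) :
  is_derive (x + t *: v) v f d -> is_derive t (1 : R) (fun t : R => f (x + t *: v)) d.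
Proof.
have E : (fun h : R => h^-1 *: (((fun t : R => f (x + t *: v)) \o shift t) (h *: 1) - f (x + t *: v)))
  = (fun h : R => h^-1 *: ((f \o shift (x + t *: v)) (h *: v) - f (x + t *: v))).
  apply/funext => h /=; congr (_ *: (f _ - _)).
  by rewrite [h *: 1]mulr1 scalerDl addrCA.
by case=> cf dE; split; rewrite /derivable /derive E.
Qed.

(** A positive maximum over [K] must lie in [D], and there every pure second derivative is at most
    [0] along its coordinate line, against the positive sum. That positivity is demanded only where
    [h > 0], so that nonlinear terms can be compared using the sign of [h]. *)
Lemma max_principle (R : realType) (N : nat) (K D : set 'rV[R]_N)
    (h : 'rV[R]_N -> R) (h1 h2 : 'I_N -> 'rV[R]_N -> R) :
  compact K -> open D -> D `<=` K -> {within K, continuous h} ->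
  (forall x, K x -> ~ D x -> h x <= 0) ->
  (forall i x, D x -> is_derive x 'e_i h (h1 i x)) ->
  (forall i x, D x -> is_derive x 'e_i (h1 i) (h2 i x)) ->
  (forall x, D x -> 0 < h x -> 0 < \sum_i h2 i x) ->
  forall x, K x -> h x <= 0.
Proof.
move=> cK oD DK ch hb dh dh1 hs x Kx.
have [c] := @EVT_max_rV _ _ h K (ex_intro _ x Kx) cK ch.
rewrite inE => Kc cmax; rewrite leNgt; apply/negP => hx.
have hc : 0 < h c by rewrite (lt_le_trans hx)// cmax// inE.
have Dc : D c by apply: contrapT => nD; have := hb _ Kc nD; rewrite leNgt hc.
have := hs _ Dc hc; rewrite ltNge => /negP; apply.
apply: sumr_le0 => i _.
have [e /= e0 He] : \forall t \near (0 : R), D (c + t *: 'e_i).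
  have : (fun t : R => c + t *: ('e_i : 'rV[R]_N)) @ (0 : R) --> c + (0 : R) *: 'e_i.
    by apply: cvgD; [exact: cvg_cst|apply: cvgZr_tmp; exact: cvg_id].
  rewrite scale0r addr0; apply.
  exact: open_nbhs_nbhs.
have De (t : R) : `|t| < e -> D (c + t *: 'e_i).
  by move=> te; apply: He; rewrite /= sub0r normrN.
apply: (@derive2_le0_at_max _ (fun t => h (c + t *: 'e_i))
  (fun t => h1 i (c + t *: 'e_i)) _ e) => //.
- by move=> t /De /(dh i) H; exact: is_derive_line.
- by apply: is_derive_line; rewrite scale0r addr0; exact: dh1.
- by move=> t /De /DK Kt; rewrite scale0r addr0 cmax// inE.
Qed.

(** * Concave one-variable barriers *)

Lemma exists_powR_ge (R : realType) (s b : R) :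
  0 <= s -> exists2 A : R, 1 <= A & b <= A `^ (1 + s).
Proof.
move=> s0; exists (Num.max 1 b); first by rewrite le_max lexx.
apply: le_trans (le1r_powR _ _); rewrite ?le_max ?lexx ?orbT//.
by rewrite lerDl.
Qed.

(** Take [W = A y^a] with [a = (p + 2) / q], so that [W^q] is a multiple of [y^(p + 2)]. Then
    [- W'' W^s = A^(1 + s) a (1 - a) y^e] with [e = a (1 + s) - 2]. The hypotheses say [a < 1] and
    [e <= 0], so this is smallest at [y = D]. *)
Lemma sublinear_barrier (R : realType) (p q s E D : R) :
  0 < p -> 0 < q -> 0 < s -> 0 < E -> 1 <= D ->
  p + 2 < q -> (p + 2) * (1 + s) <= 2 * q ->
  exists (W W1 W2 : R -> R) (C : R), 0 < C /\
    forall y : R, 0 < y -> y <= D ->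
      [/\ is_derive y (1 : R) W (W1 y), is_derive y (1 : R) W1 (W2 y),
          0 < W y, W2 y <= - (E / W y `^ s)
        & W y `^ q <= C * y `^ (p + 2)].
Proof.
move=> p0 q0 s0 E0 D1 pq psq.
pose a := (p + 2) / q.
have aq : a * q = p + 2 by rewrite /a divfK// gt_eqF.
have a0 : 0 < a by rewrite divr_gt0//; lra.
have a1 : a < 1 by rewrite ltr_pdivrMr// mul1r.
have as2 : a * (1 + s) <= 2.
  by rewrite /a mulrAC ler_pdivrMr.
have D0 : 0 < D by lra.
pose e := a * (1 + s) - 2.
have k0 : 0 < a * (1 - a) * D `^ e by apply: mulr_gt0; [apply: mulr_gt0; rewrite ?subr_gt0|exact: powR_gt0].
(* Scaling [W] by [A] scales [- W'' W^s] by [A^(1 + s)], so a large [A] beats [E]. *)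
have [A A1 AE] := exists_powR_ge (E / (a * (1 - a) * D `^ e)) (ltW s0).
have A0 : 0 < A by lra.
exists (fun y => A * y `^ a), (fun y => A * a * y `^ (a - 1)).
exists (fun y => A * a * (a - 1) * y `^ (a - 1 - 1)), (A `^ q).
split; first exact: powR_gt0.
move=> y y0 yD; split.
- have H := is_derive1_powR a y0.
  by apply: is_derive_eq; rewrite /GRing.scale/=; ring.
- have H := is_derive1_powR (a - 1) y0.
  by apply: is_derive_eq; rewrite /GRing.scale/=; ring.
- by rewrite mulr_gt0// powR_gt0.
- rewrite powRM ?powR_ge0// -?powRrM; last exact: ltW.
  rewrite lerNr.
  rewrite ler_pdivrMr ?mulr_gt0 ?powR_gt0//.
  have -> : - (A * a * (a - 1) * y `^ (a - 1 - 1)) * (A `^ s * y `^ (a * s))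
    = (A * A `^ s) * (a * (1 - a)) * (y `^ (a - 1 - 1) * y `^ (a * s)) by ring.
  rewrite -powRD; last by rewrite (gt_eqF y0) implybT.
  rewrite -{1}(powRr1 (ltW A0)) -powRD; last by rewrite (gt_eqF A0) implybT.
  have -> : a - 1 - 1 + a * s = e by rewrite /e; ring.
  apply: (@le_trans _ _ (A `^ (1 + s) * (a * (1 - a)) * D `^ e)).
    by rewrite -mulrA -ler_pdivrMr.
  apply: ler_wpM2l; first by rewrite mulr_ge0 ?powR_ge0// mulr_ge0 ?subr_ge0// ltW.
  (* As [e <= 0], the comparison of [y^e] with [D^e] is passed to the inverses, where the exponent
     is nonnegative. *)
  have [e' e'0 ->] : exists2 e', 0 <= e' & e = - e'.
    by exists (- e); rewrite ?opprK// /e oppr_ge0 subr_le0.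
  rewrite !powRN lef_pV2 ?posrE ?powR_gt0//.
  by apply: ge0_ler_powR; rewrite ?nnegrE ?(ltW y0) ?(ltW D0).
- by rewrite powRM ?powR_ge0 ?(ltW A0)// -powRrM aq.
Qed.

(** When [q = p + 2] the exponent [(p + 2) / q] is [1] and a pure power is no longer strictly
    concave. Instead a linear function is corrected by [- y^(2 - s)], whose second derivative is a
    negative multiple of [y^(- s)]. Since [A y <= W], that dominates [E / W^s] for large [A]. *)
Lemma linear_barrier (R : realType) (p q s E D : R) :
  0 < p -> 0 < q -> 0 < s -> 0 < E -> 1 <= D -> s < 1 -> p + 2 <= q ->
  exists (W W1 W2 : R -> R) (C : R), 0 < C /\
    forall y : R, 0 < y -> y <= D ->
      [/\ is_derive y (1 : R) W (W1 y), is_derive y (1 : R) W1 (W2 y),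
          0 < W y, W2 y <= - (E / W y `^ s)
        & W y `^ q <= C * y `^ (p + 2)].
Proof.
move=> p0 q0 s0 E0 D1 s1 pq.
have k0 : 0 < (2 - s) * (1 - s) by rewrite mulr_gt0//; lra.
have [A A1 AE] := exists_powR_ge (E / ((2 - s) * (1 - s))) (ltW s0).
have A0 : 0 < A by lra.
have D0 : 0 < D by lra.
(* This gives [K - y^(1 - s) >= 1] on [(0, D]], hence [W >= A y]. *)
pose K := D `^ (1 - s) + 1.
have K0 : 0 < K by rewrite /K; have := powR_gt0 (1 - s) D0; lra.
exists (fun y => A * (K * y - y `^ (2 - s))).
exists (fun y => A * (K - (2 - s) * y `^ (1 - s))).
exists (fun y => - (A * ((2 - s) * (1 - s) * y `^ (- s)))).
(* From [W <= A K y]; the surplus power [y^(q - (p + 2))] is bounded by its value at [D]. *)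
exists ((A * K) `^ q * D `^ (q - (p + 2))).
split; first by rewrite mulr_gt0// powR_gt0// mulr_gt0.
move=> y y0 yD.
have y2s : y `^ (2 - s) = y * y `^ (1 - s).
  rewrite -{2}(powRr1 (ltW y0)) -powRD; last by rewrite (gt_eqF y0) implybT.
  by congr (_ `^ _); ring.
have y1s : y `^ (1 - s) <= D `^ (1 - s).
  apply: ge0_ler_powR; rewrite ?nnegrE ?(ltW y0) ?(ltW D0)//; lra.
have Wy : A * y <= A * (K * y - y `^ (2 - s)).
  rewrite ler_pM2l// y2s /K.
  have := ler_wpM2l (ltW y0) y1s; lra.
have W0 : 0 < A * (K * y - y `^ (2 - s)).
  by rewrite (lt_le_trans _ Wy)// mulr_gt0.
split; [| |exact: W0| |].
- have H := is_derive1_powR (2 - s) y0.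
  apply: is_derive_eq.
  have -> : 2 - s - 1 = 1 - s by ring.
  by rewrite /GRing.scale/=; ring.
- have H := is_derive1_powR (1 - s) y0.
  apply: is_derive_eq.
  have -> : 1 - s - 1 = - s by ring.
  by rewrite /GRing.scale/=; ring.
- rewrite lerN2 ler_pdivrMr ?powR_gt0//.
  apply: (@le_trans _ _ (A * ((2 - s) * (1 - s) * y `^ (- s)) * (A * y) `^ s)).
    rewrite powRM ?(ltW A0) ?(ltW y0)// powRN.
    have -> : A * ((2 - s) * (1 - s) * (y `^ s)^-1) * (A `^ s * y `^ s)
      = (A * A `^ s) * ((2 - s) * (1 - s)).
      by field; rewrite gt_eqF// powR_gt0.
    rewrite -{1}(powRr1 (ltW A0)) -powRD; last by rewrite (gt_eqF A0) implybT.
    by rewrite -ler_pdivrMr.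
  rewrite ler_wpM2l//.
    by rewrite mulr_ge0 ?(ltW A0)// mulr_ge0 ?powR_ge0 ?(ltW k0).
  apply: ge0_ler_powR; rewrite ?nnegrE ?(ltW s0) ?(ltW W0)//.
  by rewrite mulr_ge0 ?ltW.
- apply: (@le_trans _ _ ((A * K * y) `^ q)).
    apply: ge0_ler_powR; rewrite ?nnegrE ?(ltW q0) ?(ltW W0) ?mulr_ge0 ?ltW//.
    by rewrite -mulrA ltr_pM2l// ltrBlDr ltrDl powR_gt0.
  have AK0 : 0 <= A * K by rewrite mulr_ge0 ?ltW.
  rewrite (powRM _ AK0 (ltW y0)) -mulrA; apply: ler_wpM2l; first exact: powR_ge0.
  have -> : y `^ q = y `^ (q - (p + 2)) * y `^ (p + 2).
    by rewrite -powRD ?subrK// (gt_eqF y0) implybT.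
  apply: ler_wpM2r; first exact: powR_ge0.
  by apply: ge0_ler_powR; rewrite ?nnegrE ?(ltW y0) ?(ltW D0)// subr_ge0.
Qed.

(** * A second-order Taylor bound *)

Lemma nbhs_box (R : realType) (N : nat) (x : 'rV[R]_N) (A : set 'rV[R]_N) :
  nbhs x A -> exists2 d : R, 0 < d &
    forall y : 'rV[R]_N, (forall j, `|y ord0 j - x ord0 j| < d) -> A y.
Proof.
move=> /nbhs_ballP[d /= d0 dA]; exists d => // y H; apply: dA.
by split=> // i j; rewrite ord1 /ball/= distrC.
Qed.

Lemma mean_value_bound (R : realType) (f g : R -> R) (a b c : R) :
  (forall t : R, `|t| <= `|a| -> is_derive t (1 : R) f (g t)) ->
  (forall t, `|t| <= `|a| -> `|g t - c| <= b) ->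
  `|f a - f 0 - c * a| <= b * `|a|.
Proof.
move=> df gb.
have cf : {within [set t | `|t| <= `|a|], continuous f}.
  apply: continuous_in_subspaceT => t; rewrite inE/= => /df[+ _].
  by move=> /derivable1_diffP; exact: differentiable_continuous.
have [t ta ->] : exists2 t, `|t| <= `|a| & f a - f 0 = g t * a.
  have [a0|/ltW a0] := leP 0 a.
    have sub (t : R) : 0 <= t -> t <= a -> `|t| <= `|a|.
      by move=> t0 ta; rewrite !ger0_norm.
    have [t] : exists2 t, t \in `[0, a] & f a - f 0 = g t * (a - 0).
      apply: MVT_segment => //.
        move=> t; rewrite in_itv/= => /andP[t0 ta]; apply: df.
        by apply: sub; exact: ltW.
      apply: continuous_subspaceW cf => t /=; rewrite in_itv/= => /andP[].
      exact: sub.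
    rewrite subr0 in_itv/= => /andP[t0 ta] fE; exists t => //; exact: sub.
  have sub (t : R) : a <= t -> t <= 0 -> `|t| <= `|a|.
    by move=> t0 ta; rewrite !ler0_norm// lerN2.
  have [t] : exists2 t, t \in `[a, 0] & f 0 - f a = g t * (0 - a).
    apply: MVT_segment => //.
      move=> t; rewrite in_itv/= => /andP[t0 ta]; apply: df.
      by apply: sub; exact: ltW.
    apply: continuous_subspaceW cf => t /=; rewrite in_itv/= => /andP[].
    exact: sub.
  rewrite in_itv/= => /andP[t0 ta] fE; exists t; first exact: sub.
  by rewrite -opprB fE; ring.
by rewrite -mulrBl normrM ler_wpM2r// gb.
Qed.

(** Go from [x] to [x + h] changing one coordinate at a time: [P k] has the first [k] coordinates
    moved. Each leg is a one-variable mean value estimate inside the box spanned by [h], and the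
    errors add up. *)
Lemma partial_mean_value_bound (R : realType) (N : nat) (f : 'rV[R]_N -> R)
    (g : 'I_N -> 'rV[R]_N -> R) (c : 'I_N -> R) (x h : 'rV[R]_N) (b : R) :
  (forall z : 'rV[R]_N, (forall j, `|z ord0 j - x ord0 j| <= `|h ord0 j|) ->
     forall i, is_derive z 'e_i f (g i z) /\ `|g i z - c i| <= b) ->
  `|f (x + h) - f x - \sum_i c i * h ord0 i| <= b * \sum_i `|h ord0 i|.
Proof.
move=> H.
pose P (k : nat) : 'rV[R]_N := x + \row_j (if (j < k)%N then h ord0 j else 0).
have PS (k : 'I_N) : P k.+1 = P k + h ord0 k *: 'e_k.
  rewrite /P -addrA; congr (_ + _); apply/rowP => j; rewrite !mxE eqxx/= ltnS.
  have [->|jk] := eqVneq j k; first by rewrite leqnn ltnn add0r mulr1.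
  rewrite mulr0 addr0 ltn_neqAle.
  by have -> : (j : nat) != k by [].
have Pk (k : nat) : (k <= N)%N ->
    `|f (P k) - f x - \sum_(i < N | (i < k)%N) c i * h ord0 i|
      <= b * \sum_(i < N | (i < k)%N) `|h ord0 i|.
  elim: k => [_|k IH kN].
    rewrite !big_pred0// mulr0 subr0.
    have -> : P 0%N = x by apply/rowP => j; rewrite !mxE addr0.
    by rewrite subrr normr0.
  pose k' := Ordinal kN.
  have split_last (F : 'I_N -> R) :
      \sum_(i < N | (i < k.+1)%N) F i = F k' + \sum_(i < N | (i < k)%N) F i.
    rewrite (bigD1 k')//=; congr (_ + _); apply: eq_bigl => i.
    rewrite ltnS [in RHS]ltn_neqAle andbC; congr (_ && _).
  have PkS := PS k'; rewrite /= in PkS; rewrite !split_last mulrDr.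
  have -> : f (P k.+1) - f x - (c k' * h ord0 k' +
      \sum_(i < N | (i < k)%N) c i * h ord0 i) =
    (f (P k.+1) - f (P k) - c k' * h ord0 k') +
    (f (P k) - f x - \sum_(i < N | (i < k)%N) c i * h ord0 i) by ring.
  apply: le_trans (ler_normD _ _) _; apply: lerD; last exact/IH/ltnW.
  have inbox (t : R) : `|t| <= `|h ord0 k'| ->
      forall j, `|(P k + t *: 'e_k') ord0 j - x ord0 j| <= `|h ord0 j|.
    move=> th j; rewrite !mxE eqxx/=.
    have [->|jk] := eqVneq j k'; first by rewrite /= ltnn addr0 mulr1 addrC addKr.
    by rewrite mulr0 addr0 addrC addKr; case: ifP => //; rewrite normr0.
  have := @mean_value_bound _ (fun t => f (P k + t *: 'e_k'))
    (fun t => g k' (P k + t *: 'e_k')) (h ord0 k') b (c k').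
  rewrite PkS scale0r addr0; apply => t /inbox/H/(_ k')[dk bk] //.
  exact: is_derive_line.
have -> : x + h = P N.
  by apply/rowP => j; rewrite !mxE ltn_ord.
have := Pk N (leqnn N).
have E (F : 'I_N -> R) : \sum_(i < N | (i < N)%N) F i = \sum_i F i.
  by apply: eq_bigl => i; rewrite ltn_ord.
by rewrite !E.
Qed.

Lemma Ck_on_is_derive2 (R : realType) (N : nat) (U : set 'rV[R]_N)
    (f : 'rV[R]_N -> R) (i j : 'I_N) (x : 'rV[R]_N) : Ck_on 2 U f -> U x ->
  is_derive x 'e_i f ('D_'e_i f x) /\
  is_derive x 'e_j ('D_'e_i f) ('D_'e_j ('D_'e_i f) x).
Proof.
move=> [_ /(_ i)[df [_ /(_ j)[d2f _]]]] Ux.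
by split; apply: derivableP; [exact: df|exact: d2f].
Qed.

(** Sum [2 F_i F_j <= F_i^2 + F_j^2] over all pairs. *)
Lemma sqr_sum_le (R : realType) (N : nat) (F : 'I_N -> R) :
  (\sum_i F i) ^+ 2 <= N%:R * \sum_i F i ^+ 2.
Proof.
have E1 : \sum_(i < N) \sum_(j < N) F i ^+ 2 = N%:R * \sum_i F i ^+ 2.
  rewrite mulr_sumr; apply: eq_bigr => i _.
  by rewrite sumr_const card_ord mulr_natl.
have E2 : \sum_(i < N) \sum_(j < N) F j ^+ 2 = N%:R * \sum_i F i ^+ 2.
  by rewrite sumr_const card_ord mulr_natl.
suff : 2 * (\sum_i F i) ^+ 2 <= N%:R * \sum_i F i ^+ 2 + N%:R * \sum_i F i ^+ 2.
  lra.
rewrite -[X in X + _]E1 -[X in _ + X]E2 -big_split/= expr2 mulr_suml mulr_sumr.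
apply: ler_sum => i _; rewrite -big_split/= !mulr_sumr; apply: ler_sum => j _.
have := sqr_ge0 (F i - F j); lra.
Qed.

(** Second partials are bounded by some [b] near [x], by continuity. The previous mean value bound
    is used twice: on each partial derivative with slopes [0], giving a Lipschitz gradient, then on
    [f] with the slopes of the gradient at [x]. The remainder [b (sum |h_i|)^2] is at most
    [b N sum h_i^2]. *)
Lemma taylor_upper_bound (R : realType) (N : nat) (U : set 'rV[R]_N)
    (f : 'rV[R]_N -> R) (x : 'rV[R]_N) :
  open U -> U x -> Ck_on 2 U f ->
  exists d K : R, [/\ 0 < d, 0 <= K & forall h : 'rV[R]_N,
    (forall j, `|h ord0 j| < d) -> U (x + h) /\
    f (x + h) <= f x + \sum_i 'D_'e_i f x * h ord0 i + K * \sum_i h ord0 i ^+ 2].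
Proof.
move=> oU Ux fC2.
have [_ fC1] := fC2.
pose f2 (i j : 'I_N) := 'D_'e_j ('D_'e_i f).
(* The [1] makes the bound strict at [x], so that it persists on a neighbourhood. *)
pose b := 1 + \sum_i \sum_j `|f2 i j x|.
have b_gt (i j : 'I_N) : `|f2 i j x| < b.
  have le1 : `|f2 i j x| <= \sum_k `|f2 i k x|.
    by rewrite (bigD1 j)//= lerDl; exact: sumr_ge0.
  have le2 : \sum_k `|f2 i k x| <= \sum_l \sum_k `|f2 l k x|.
    by rewrite [leRHS](bigD1 i)//= lerDl; apply: sumr_ge0 => l _; exact: sumr_ge0.
  by apply: le_lt_trans (le_trans le1 le2) _; rewrite /b ltrDr ltr01.
have b0 : 0 < b.
  by rewrite /b ltr_pwDl// sumr_ge0// => i _; exact: sumr_ge0.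
have near_b : \forall z \near x, forall ij : 'I_N * 'I_N, `|f2 ij.1 ij.2 z| <= b.
  refine (@filter_forall _ _ (fun (ij : 'I_N * 'I_N) z => `|f2 ij.1 ij.2 z| <= b) (nbhs x) _ _) => -[i j] /=.
  have [_ [_ /(_ j)[_ f2c]]] := fC1 i.
  have : (fun z => `|f2 i j z|) @ x --> `|f2 i j x|.
    have fx : {for x, continuous (f2 i j)} by apply: f2c; rewrite inE.
    exact: continuous_comp fx (@norm_continuous _ _ _).
  move=> /(@cvgrPdist_lt _ _ _ (nbhs x))/(_ (b - `|f2 i j x|)).
  rewrite subr_gt0 => /(_ (b_gt i j)); apply: filterS => z /=.
  by rewrite ltr_distlC => /andP[_]; rewrite addrC subrK => /ltW.
have [d d0 dU] := nbhs_box (filterI (open_nbhs_nbhs (conj oU Ux)) near_b).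
have {}dU (z : 'rV[R]_N) : (forall j, `|z ord0 j - x ord0 j| < d) ->
    U z /\ forall i j, `|f2 i j z| <= b.
  by move=> /dU[Uz Bz]; split; [exact: Uz|move=> i j; exact: (Bz (i, j))].
exists d, (b * N%:R); split => //; first by rewrite mulr_ge0// ltW.
move=> h hd; split.
  by have [] // := dU (x + h) => j; rewrite mxE addrAC subrr add0r.
have gradient_bound (z : 'rV[R]_N) :
    (forall j, `|z ord0 j - x ord0 j| <= `|h ord0 j|) ->
    forall i, `|'D_'e_i f z - 'D_'e_i f x| <= b * \sum_j `|h ord0 j|.
  move=> zh i.
  have := @partial_mean_value_bound R N ('D_'e_i f) (fun j => f2 i j)
    (fun=> 0) x (z - x) b.
  have -> : x + (z - x) = z by rewrite addrC subrK.
  rewrite big1 ?subr0; last by move=> j _; rewrite mul0r.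
  move=> H; apply: le_trans (H _) _ => [y yz j|].
    have yd (k : 'I_N) : `|y ord0 k - x ord0 k| < d.
      by apply: le_lt_trans (hd k); apply: le_trans (zh k); have := yz k; rewrite !mxE.
    have [Uy By] := dU _ yd; rewrite subr0; split=> //.
    by have [] := Ck_on_is_derive2 i j fC2 Uy.
  apply: ler_wpM2l; first exact: ltW.
  by apply: ler_sum => j _; rewrite !mxE.
have := @partial_mean_value_bound R N f (fun i => 'D_'e_i f)
  (fun i => 'D_'e_i f x) x h (b * \sum_j `|h ord0 j|).
move=> H; have {H} : `|f (x + h) - f x - \sum_i 'D_'e_i f x * h ord0 i|
    <= b * N%:R * \sum_i h ord0 i ^+ 2.
  apply: le_trans (H _) _.
    move=> z zh i; split; last exact: gradient_bound.
    have zd (k : 'I_N) : `|z ord0 k - x ord0 k| < d by exact: le_lt_trans (hd k).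
    have [Uz _] := dU _ zd.
    by have [] := Ck_on_is_derive2 i i fC2 Uz.
  rewrite -!mulrA ler_pM2l// -expr2 (le_trans (sqr_sum_le _))//.
  by under eq_bigr => i _ do rewrite real_normK ?num_real//.
by move=> /ler_normlP[_]; lra.
Qed.

(** * Interior tangent balls *)

(** The Euclidean norm is kept squared, hence polynomial and differentiable everywhere; radii are
    accordingly given by their squares. *)
Definition sqnorm (R : realType) (N : nat) (x : 'rV[R]_N) : R :=
  \sum_i x ord0 i ^+ 2.

Lemma sqnorm_ge0 (R : realType) (N : nat) (x : 'rV[R]_N) : 0 <= sqnorm x.
Proof. by apply: sumr_ge0 => i _; exact: sqr_ge0. Qed.

Lemma sqnorm_gt0 (R : realType) (N : nat) (x : 'rV[R]_N) (i : 'I_N) :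
  x ord0 i != 0 -> 0 < sqnorm x.
Proof.
move=> xi; rewrite /sqnorm (bigD1 i)//= ltr_pwDl//; first by rewrite exprn_even_gt0.
by apply: sumr_ge0 => j _; exact: sqr_ge0.
Qed.

Lemma ler_sqnorm (R : realType) (N : nat) (x : 'rV[R]_N) (i : 'I_N) :
  x ord0 i ^+ 2 <= sqnorm x.
Proof.
rewrite /sqnorm (bigD1 i)//= lerDl.
by apply: sumr_ge0 => j _; exact: sqr_ge0.
Qed.

(** Let [n] be the gradient at [x0], [m = n / (2 L)] and [x = x0 + h]. Membership in the ball reads
    [n . h <= - L |h|^2], so the Taylor bound gives [f x <= (K - L) |h|^2 < 0] once [L > K]. *)
Lemma interior_ball (R : realType) (N : nat) (U Omega : set 'rV[R]_N)
    (f : 'rV[R]_N -> R) (x0 : 'rV[R]_N) :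
  open U -> U x0 -> Ck_on 2 U f -> (exists i, 'D_'e_i f x0 != 0) ->
  f x0 = 0 -> (forall x, U x -> f x < 0 -> Omega x) ->
  exists2 m : 'rV[R]_N, 0 < sqnorm m &
    forall x, x != x0 -> sqnorm (x - (x0 - m)) <= sqnorm m -> Omega x.
Proof.
move=> oU Ux0 fC2 [i0 fi0] fx0 fO.
have [d [K [d0 K0 fK]]] := taylor_upper_bound oU Ux0 fC2.
pose n : 'rV[R]_N := \row_i 'D_'e_i f x0.
have n0 : 0 < sqnorm n by apply: (@sqnorm_gt0 _ _ _ i0); rewrite mxE.
(* The first entry ensures [L > K] and [L >= 1]; the second makes the diameter [|n| / L] of the ball
   less than [d], so the Taylor bound applies on all of it. *)
pose L := Num.max (K + 1) ((sqnorm n + 1) / d ^+ 2).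
have LK : K < L by rewrite lt_max ltrDl ltr01.
have L0 : 0 < L by exact: le_lt_trans LK.
have Ld : sqnorm n < L ^+ 2 * d ^+ 2.
  apply: (@lt_le_trans _ _ (sqnorm n + 1)); first by rewrite ltrDl.
  rewrite -ler_pdivrMr ?exprn_gt0// (@le_trans _ _ L)//.
    by rewrite le_max lexx orbT.
  rewrite expr2 ler_peMl ?(ltW L0)// le_max; apply/orP; left; lra.
have mE : sqnorm ((2 * L)^-1 *: n) = (2 * L) ^- 2 * sqnorm n.
  rewrite /sqnorm mulr_sumr; apply: eq_bigr => i _.
  by rewrite mxE exprMn exprVn.
exists ((2 * L)^-1 *: n).
  by rewrite mE mulr_gt0// invr_gt0 exprn_gt0// mulr_gt0.
move=> x xx0; set m := _ *: n; pose h := x - x0.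
have -> : x - (x0 - m) = h + m by rewrite /h opprB addrA addrAC.
move=> hm.
have hN0 : 0 < sqnorm h.
  have : h != 0 by rewrite subr_eq0.
  move=> /rV0Pn[i hi]; exact: (@sqnorm_gt0 _ _ _ i).
have hd j : `|h ord0 j| < d.
  rewrite -ltr_sqr ?nnegrE ?(ltW d0)// real_normK ?num_real//.
  have hmj : (h ord0 j + m ord0 j) ^+ 2 <= sqnorm m.
    by apply: le_trans hm; have := ler_sqnorm (h + m) j; rewrite !mxE.
  have mj := ler_sqnorm m j.
  have m4 : 4 * sqnorm m < d ^+ 2.
    rewrite mE -(@ltr_pM2l _ (L ^+ 2)) ?exprn_gt0//.
    by have -> : L ^+ 2 * (4 * ((2 * L) ^- 2 * sqnorm n)) = sqnorm n
      by field; rewrite gt_eqF.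
  (* With [a = h_j + m_j], this is [(a - m_j)^2 <= 2 a^2 + 2 m_j^2 <= 4 |m|^2 < d^2]. *)
  have := sqr_ge0 (h ord0 j + m ord0 j + m ord0 j); nra.
have [Ux fx] := fK _ hd.
have xE : x0 + h = x by rewrite /h addrC subrK.
rewrite xE in Ux fx; apply: fO => //.
apply: le_lt_trans fx _.
have hmE : sqnorm (h + m) =
    sqnorm h + L^-1 * (\sum_i 'D_'e_i f x0 * h ord0 i) + sqnorm m.
  rewrite /sqnorm mulr_sumr -!big_split/=; apply: eq_bigr => i _.
  by rewrite !mxE; field; rewrite gt_eqF.
have : sqnorm h + L^-1 * (\sum_i 'D_'e_i f x0 * h ord0 i) <= 0.
  by move: hm; rewrite hmE gerDr.
rewrite -(ler_pM2l L0) mulr0 mulrDr mulVKf ?gt_eqF// => H.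
rewrite fx0 add0r; apply: lt_le_trans H.
by rewrite addrC ltrD2r -/(sqnorm h) ltr_pM2r.
Qed.

(** * Radial barriers on Euclidean balls *)

Lemma is_derive_coord (R : realType) (N : nat) (x v : 'rV[R]_N) (j : 'I_N) :
  is_derive x v (fun y : 'rV[R]_N => y ord0 j) (v ord0 j).
Proof.
have E : (fun h : R => h^-1 *: (((fun y : 'rV[R]_N => y ord0 j) \o shift x) (h *: v) - x ord0 j))
    @ 0^' --> v ord0 j.
  apply: cvg_near_cst; near=> h.
  rewrite /= !mxE addrK [_ *: _]mulrA mulVf ?mul1r//.
  by near: h; exact: nbhs_dnbhs_neq.
by split; [apply/cvg_ex; exists (v ord0 j)|apply: cvg_lim].
Unshelve. all: by end_near. Qed.

Lemma is_derive_comp_coord (R : realType) (N : nat) (W : R -> R) (c d : R)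
    (i j : 'I_N) (x : 'rV[R]_N) :
  is_derive (c - x ord0 j) (1 : R) W d ->
  is_derive x 'e_i (fun y : 'rV[R]_N => W (c - y ord0 j)) (- (i == j)%:R * d).
Proof.
move=> [/derivable1_diffP dW <-].
pose g (y : 'rV[R]_N) := c - y ord0 j.
have dg : differentiable g x.
  by apply: differentiableB; [exact: differentiable_cst|exact: differentiable_coord].
have gE : 'D_'e_i g x = - (i == j)%:R.
  have H := is_derive_coord x 'e_i j.
  have : is_derive x 'e_i g (0 - ('e_i : 'rV[R]_N) ord0 j).
    exact: (@is_deriveB _ _ _ (cst c)).
  by case=> _ ->; rewrite sub0r mxE eqxx/= eq_sym.
have dWg : differentiable (W \o g) x by exact: differentiable_comp.
split; first exact: diff_derivable.
rewrite (deriveE _ dWg) diff_comp//= -(deriveE _ dg) gE diff1E//.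
by rewrite derive1E.
Qed.

Section ball_barrier.
Context (R : realType) (N : nat) (y : 'rV[R]_N) (c e k : R).

(* [k > 0] serves for the Hopf barrier, [k = 0] for the paraboloid. *)
Definition ball_barrier (x : 'rV[R]_N) : R :=
  e * ((c - sqnorm (x - y)) + k * (c - sqnorm (x - y)) ^+ 2).

Definition ball_barrier1 (i : 'I_N) (x : 'rV[R]_N) : R :=
  - (2 * e * (1 + 2 * k * (c - sqnorm (x - y))) * (x ord0 i - y ord0 i)).

Definition ball_barrier2 (i : 'I_N) (x : 'rV[R]_N) : R :=
  e * (8 * k * (x - y) ord0 i ^+ 2 - 2 * (1 + 2 * k * (c - sqnorm (x - y)))).

Lemma is_derive_sqnorm (i : 'I_N) (x : 'rV[R]_N) :
  is_derive x 'e_i (fun z => sqnorm (z - y)) (2 * (x ord0 i - y ord0 i)).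
Proof.
have -> : (fun z => sqnorm (z - y)) =
    \sum_(j < N) ((fun z : 'rV[R]_N => z ord0 j) - cst (y ord0 j)) ^+ 2.
  apply/funext => z; rewrite /sqnorm fct_sumE; apply: eq_bigr => j _.
  by rewrite !mxE.
have H j : is_derive x 'e_i (((fun z : 'rV[R]_N => z ord0 j) - cst (y ord0 j)) ^+ 2)
    ((2%:R * (x ord0 j - y ord0 j) ^+ 1) *: ((j == i)%:R - 0)).
  apply: is_deriveX; apply: is_deriveB.
  have := is_derive_coord x 'e_i j; by rewrite mxE eqxx.
apply: is_derive_eq.
rewrite (bigD1 i)//= eqxx big1 => [|j /negPf->].
  by rewrite addr0 subr0 expr1 [LHS]mulr1.
by rewrite subr0 scaler0.
Qed.

Lemma sqnorm_continuous : continuous (fun z : 'rV[R]_N => sqnorm (z - y)).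
Proof.
move=> x.
have -> : (fun z => sqnorm (z - y)) =
    \sum_(j < N) ((fun z : 'rV[R]_N => z ord0 j) - cst (y ord0 j)) ^+ 2.
  apply/funext => z; rewrite /sqnorm fct_sumE; apply: eq_bigr => j _.
  by rewrite !mxE.
apply: differentiable_continuous; apply: differentiable_sum => j.
apply: differentiableX; apply: differentiableB; first exact: differentiable_coord.
exact: differentiable_cst.
Qed.

Lemma ball_barrier_continuous : continuous ball_barrier.
Proof.
pose P (t : R) := e * ((c - t) + k * (c - t) ^+ 2).
have cP : continuous P.
  move=> t; apply: differentiable_continuous; apply/derivable1_diffP.
  by rewrite /P; apply: derivableM; [exact: derivable_cst|].
move=> x; exact: (continuous_comp (@sqnorm_continuous x) (cP _)).
Qed.

Lemma is_derive_ball_barrier (i : 'I_N) (x : 'rV[R]_N) :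
  is_derive x 'e_i ball_barrier (ball_barrier1 i x).
Proof.
have H := is_derive_sqnorm i x.
pose S z : R := sqnorm (z - y).
have -> : ball_barrier = e \*: ((cst c - S) + k \*: (cst c - S) ^+ 2).
  by apply/funext.
apply: is_derive_eq.
have E : (cst c - S) x = c - sqnorm (x - y) by [].
by rewrite /ball_barrier1 /GRing.scale/= E; ring.
Qed.

Lemma is_derive_ball_barrier1 (i : 'I_N) (x : 'rV[R]_N) :
  is_derive x 'e_i (ball_barrier1 i) (ball_barrier2 i x).
Proof.
have H := is_derive_sqnorm i x.
have H' : is_derive x 'e_i (fun z : 'rV[R]_N => z ord0 i) 1.
  by have := is_derive_coord x 'e_i i; rewrite mxE !eqxx.
pose S z : R := sqnorm (z - y).
have -> : ball_barrier1 i = (- (2 * e)) \*: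
    ((cst 1 + (2 * k) \*: (cst c - S)) * ((fun z : 'rV[R]_N => z ord0 i) - cst (y ord0 i))).
  apply/funext => z; rewrite /ball_barrier1.
  rewrite -[RHS]/(- (2 * e) * ((1 + 2 * k * (c - sqnorm (z - y)))
    * (z ord0 i - y ord0 i))); ring.
apply: is_derive_eq.
have E1 : (cst 1 + (2 * k) \*: (cst c - S)) x = 1 + 2 * k * (c - sqnorm (x - y)).
  by [].
have E2 : ((fun z : 'rV[R]_N => z ord0 i) - cst (y ord0 i)) x = x ord0 i - y ord0 i.
  by [].
by rewrite /ball_barrier2 /GRing.scale/= E1 E2 !mxE; ring.
Qed.

Lemma sum_ball_barrier2 (x : 'rV[R]_N) : \sum_i ball_barrier2 i x =
  e * (8 * k * sqnorm (x - y) - 2 * N%:R * (1 + 2 * k * (c - sqnorm (x - y)))).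
Proof.
rewrite -mulr_sumr big_split/= -mulr_sumr sumr_const card_ord -mulr_natl.
by rewrite /sqnorm; ring.
Qed.

End ball_barrier.

Lemma closed_eucl_ball (R : realType) (N : nat) (y : 'rV[R]_N) (c : R) :
  closed [set x : 'rV[R]_N | sqnorm (x - y) <= c].
Proof.
have /continuous_closedP H := @sqnorm_continuous _ _ y.
apply: (H [set t | t <= c]); exact: closed_le.
Qed.

Lemma compact_eucl_ball (R : realType) (N : nat) (y : 'rV[R]_N) (c : R) :
  compact [set x : 'rV[R]_N | sqnorm (x - y) <= c].
Proof.
(* As [c] is a squared radius, [(c + 1)^2 >= c] makes the box large enough. *)
pose box (i : 'I_N) : set R := `[y ord0 i - (c + 1), y ord0 i + (c + 1)]%classic.
have cbox : compact [set v : 'rV[R]_N | forall i, box i (v ord0 i)].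
  by apply: rV_compact => i; exact: segment_compact.
apply: (subclosed_compact (@closed_eucl_ball _ _ y c) cbox) => x /= xc i.
have c0 : 0 <= c by exact: le_trans (sqnorm_ge0 _) xc.
rewrite /box/= in_itv/= -ler_distl.
rewrite -ler_sqr ?nnegrE//; last by rewrite addr_ge0.
rewrite real_normK ?num_real//.
have := ler_sqnorm (x - y) i; rewrite !mxE.
move=> /le_trans/(_ xc)/le_trans; apply; nra.
Qed.

Lemma open_eucl_annulus (R : realType) (N : nat) (y : 'rV[R]_N) (a b : R) :
  open [set x : 'rV[R]_N | a < sqnorm (x - y) < b].
Proof.
have -> : [set x : 'rV[R]_N | a < sqnorm (x - y) < b] =
    (fun x => sqnorm (x - y)) @^-1` `]a, b[%classic.
  by apply/seteqP; split => x /=; rewrite in_itv.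
apply: open_comp; last exact: interval_open.
by move=> x _; exact: sqnorm_continuous.
Qed.

Lemma compact_closure_bounded (R : realType) (N : nat) (A : set 'rV[R]_N) :
  bounded_set A -> compact (closure A).
Proof.
move=> [M [Mr AM]]; apply: bounded_closed_compact; last exact: closed_closure.
exists M; split => // b Mb; have cl : closed [set x : 'rV[R]_N | `|x| <= b].
  have /continuous_closedP H := @norm_continuous _ 'rV[R]_N.
  by apply: (H [set t | t <= b]); exact: closed_le.
move/closure_id : cl => cl x Ax.
suff : closure [set x : 'rV[R]_N | `|x| <= b] x by rewrite -cl.
by apply: closure_subset Ax => z Az; exact: AM Mb _ Az.
Qed.

(** * Comparison estimates for [u] and [v] *)

(** The maximum principle for the barrier minus [u]. The Laplacians are compared only where [u] is
    below the barrier, so [alpha * u] can be replaced there by [alpha] times the barrier. *)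
Lemma ball_comparison (R : realType) (N : nat) (Omega K D : set 'rV[R]_N)
    (u : 'rV[R]_N -> R) (y : 'rV[R]_N) (c e k : R) :
  Ck_on 2 Omega u -> {within K, continuous u} ->
  compact K -> open D -> D `<=` K -> D `<=` Omega ->
  (forall x, K x -> ~ D x -> ball_barrier y c e k x <= u x) ->
  (forall x, D x -> u x < ball_barrier y c e k x ->
    laplacian u x < \sum_i ball_barrier2 y c e k i x) ->
  forall x, K x -> ball_barrier y c e k x <= u x.
Proof.
move=> uC2 cu cK oD DK DO bd lap x Kx; rewrite -subr_le0.
apply: (@max_principle R N K D (ball_barrier y c e k - u)
  (fun i => ball_barrier1 y c e k i - 'D_'e_i u)
  (fun i => ball_barrier2 y c e k i - 'D_'e_i ('D_'e_i u))) => //.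
- apply: within_continuousB => //.
  by apply: continuous_subspaceT; exact: ball_barrier_continuous.
- by move=> z Kz nDz; rewrite subr_le0; exact: bd.
- move=> i z /DO Oz; have [d1 d2] := Ck_on_is_derive2 i i uC2 Oz.
  by apply: is_deriveB; exact: is_derive_ball_barrier.
- move=> i z /DO Oz; have [d1 d2] := Ck_on_is_derive2 i i uC2 Oz.
  by apply: is_deriveB; exact: is_derive_ball_barrier1.
- move=> z Dz; rewrite subr_gt0 => /(lap _ Dz) H.
  by rewrite big_split/= sumrN subr_gt0.
Qed.

(** With [t = r2 - |x - y|^2], the barrier [e (t + k t^2)] is compared with [u] on a thin annulus
    inside the sphere. It vanishes on the sphere, where [u >= 0]; on the smaller closed ball,
    compact in [Omega], [u] has a positive minimum, which fixes [e]. Dropping [k t^2] leaves the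
    linear bound. *)
Lemma hopf_lower_bound (R : realType) (N : nat) (Omega : set 'rV[R]_N)
    (u : 'rV[R]_N -> R) (alpha r2 : R) (x0 y : 'rV[R]_N) :
  Ck_on 2 Omega u -> {within closure Omega, continuous u} ->
  0 < alpha -> 0 < r2 -> closure Omega x0 -> 0 <= u x0 ->
  sqnorm (x0 - y) = r2 ->
  (forall x, x != x0 -> sqnorm (x - y) <= r2 -> Omega x) ->
  (forall x, Omega x -> 0 < u x) ->
  (forall x, Omega x -> laplacian u x <= alpha * u x) ->
  exists2 e : R, 0 < e &
    forall x, sqnorm (x - y) <= r2 -> e * (r2 - sqnorm (x - y)) <= u x.
Proof.
move=> uC2 cu alpha0 r20 x0O ux0 x0y inO upos lap.
pose n : R := N%:R; have n0 : 0 <= n by [].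
(* [k] makes the barrier a subsolution near the sphere, and [eta] measures how near. *)
pose k := (2 * n + 1) / r2.
have k0 : 0 < k by rewrite divr_gt0//; lra.
have kr : k * r2 = 2 * n + 1 by rewrite divfK// gt_eqF.
pose eta := (8 + 4 * n + alpha * r2)^-1.
have ar0 : 0 < alpha * r2 by rewrite mulr_gt0.
have eta_inv : eta * (8 + 4 * n + alpha * r2) = 1 by rewrite mulVf// gt_eqF; lra.
have eta0 : 0 < eta by rewrite invr_gt0; lra.
have eta1 : eta <= 1 by nra.
pose K := [set x : 'rV[R]_N | sqnorm (x - y) <= r2].
have KO : K `<=` closure Omega.
  move=> x Kx; have [->//|xx0] := eqVneq x x0.
  by apply: subset_closure; exact: inO.
pose K' := [set x : 'rV[R]_N | sqnorm (x - y) <= (1 - eta) * r2].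
have K'K : K' `<=` K by move=> x; rewrite /K/K'/=; nra.
have K'O : K' `<=` Omega.
  move=> x K'x; apply: inO; last exact: K'K.
  by apply/eqP => xx0; move: K'x; rewrite /K'/= xx0 x0y; nra.
have [c K'c umin] : exists2 c, c \in K' & forall t, t \in K' -> u c <= u t.
  apply: EVT_min_rV.
  - exists y; rewrite /K'/= subrr /sqnorm big1 => [|i _]; last by rewrite mxE expr0n.
    by rewrite mulr_ge0 ?subr_ge0// ltW.
  - exact: compact_eucl_ball.
  - by apply: continuous_subspaceW cu; apply: subset_trans K'K KO.
have uc : 0 < u c by apply: upos; apply: K'O; rewrite inE in K'c.
(* The denominator is the maximum of [t + k t^2] for [0 <= t <= r2], so the barrier stays below
   [u c]. *)
pose e := u c / (r2 + k * r2 ^+ 2).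
have q0 : 0 < r2 + k * r2 ^+ 2 by rewrite addr_gt0// mulr_gt0// exprn_gt0.
have e0 : 0 < e by rewrite divr_gt0.
pose D := [set x : 'rV[R]_N | (1 - eta) * r2 < sqnorm (x - y) < r2].
exists e => // x Kx.
apply: (@le_trans _ _ (ball_barrier y r2 e k x)).
  rewrite /ball_barrier ler_pM2l// lerDl mulr_ge0 ?sqr_ge0//; exact: ltW.
apply: (@ball_comparison R N Omega K D) => //.
- exact: continuous_subspaceW cu.
- exact: compact_eucl_ball.
- exact: open_eucl_annulus.
- by move=> z /andP[_ /ltW].
- move=> z /andP[_ zr]; apply: inO; last exact: ltW.
  by apply/eqP => zx0; move: zr; rewrite zx0 x0y ltxx.
- move=> z Kz nDz.
  have [zK'|zK'] := leP (sqnorm (z - y)) ((1 - eta) * r2).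
    apply: (@le_trans _ _ (u c)); last by apply: umin; rewrite inE.
    rewrite /ball_barrier /e mulrAC ler_pdivrMr// ler_pM2l//.
    have s0 := sqnorm_ge0 (z - y).
    have Kz' : sqnorm (z - y) <= r2 := Kz.
    apply: lerD; first lra.
    rewrite ler_pM2l// ler_sqr ?nnegrE ?subr_ge0 ?(ltW r20)//; lra.
  have zr : sqnorm (z - y) = r2.
    apply/eqP; rewrite eq_le Kz/= leNgt; apply/negP => zr; apply: nDz.
    by rewrite /D/= zK' zr.
  rewrite /ball_barrier zr subrr expr0n/= mulr0 addr0 mulr0.
  have [->//|zx0] := eqVneq z x0.
  by apply: ltW; apply: upos; exact: inO.
- move=> z /andP[z1 z2] ub.
  have Oz : Omega z.
    apply: inO; last exact: ltW.
    by apply/eqP => zx0; move: z2; rewrite zx0 x0y ltxx.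
  apply: le_lt_trans (lap _ Oz) _.
  have : alpha * u z < alpha * ball_barrier y r2 e k z by rewrite ltr_pM2l.
  move=> /lt_le_trans; apply; rewrite sum_ball_barrier2 /ball_barrier mulrCA.
  rewrite ler_pM2l// -/n.
  set S := sqnorm (z - y) in z1 z2 *.
  pose t := r2 - S; have SE : S = r2 - t by rewrite /t; ring.
  have t0 : 0 < t by rewrite subr_gt0.
  have t1 : t < eta * r2 by rewrite /t; lra.
  rewrite SE subKr.
  have kt0 : 0 < k * t by rewrite mulr_gt0.
  (* As [k r2 = 2 n + 1], the right side of the goal is [14 n + 8 - k t (8 + 4 n) >= 12 n + 7],
     while the left side [alpha t (1 + k t)] is at most [2 n + 2]. *)
  have kt1 : k * t * (8 + 4 * n) <= 2 * n + 1.
    have : k * t <= eta * (2 * n + 1).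
      by rewrite -kr mulrCA ler_pM2l// ltW.
    nra.
  have kt2 : k * t <= 2 * n + 1.
    have : k * t <= eta * (2 * n + 1).
      by rewrite -kr mulrCA ler_pM2l// ltW.
    nra.
  have at1 : alpha * t <= 1.
    have : alpha * t <= alpha * (eta * r2) by rewrite ler_pM2l// ltW.
    nra.
  have -> : alpha * (t + k * t ^+ 2) = alpha * t * (1 + k * t) by ring.
  have at2 : alpha * t * (1 + k * t) <= 1 + k * t by rewrite ler_piMl//; lra.
  have -> : 8 * k * (r2 - t) = 8 * (k * r2) - 8 * (k * t) by ring.
  rewrite kr; nra.
Qed.

(** Compare [u] with the paraboloid [A (c - |x - z|^2)], which vanishes on the sphere and has
    Laplacian [- 2 N A]. The choice [alpha A c + 2 N A = g] makes it a subsolution, and its value at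
    the centre is [A c]. For [g] of order [t^-2] and [c] of order [t^2] the bound does not
    degenerate. *)
Lemma interior_lower_bound (R : realType) (N : nat) (Omega : set 'rV[R]_N)
    (u : 'rV[R]_N -> R) (alpha c g : R) (z : 'rV[R]_N) :
  Ck_on 2 Omega u -> {within closure Omega, continuous u} ->
  0 < alpha -> 0 < c -> 0 < g ->
  (forall x, sqnorm (x - z) <= c -> Omega x) ->
  (forall x, Omega x -> 0 < u x) ->
  (forall x, sqnorm (x - z) <= c -> laplacian u x <= alpha * u x - g) ->
  g * c / (alpha * c + 2 * N%:R) <= u z.
Proof.
move=> uC2 cu alpha0 c0 g0 inO upos lap.
have q0 : 0 < alpha * c + 2 * N%:R by rewrite ltr_pwDl// mulr_gt0.
pose A := g / (alpha * c + 2 * N%:R).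
have A0 : 0 < A by rewrite divr_gt0.
have AE : alpha * A * c = g - 2 * N%:R * A.
  by rewrite /A; field; rewrite gt_eqF.
have -> : g * c / (alpha * c + 2 * N%:R) = ball_barrier z c A 0 z.
  rewrite /ball_barrier subrr /sqnorm big1 => [|i _]; last by rewrite mxE expr0n.
  by rewrite mul0r addr0 subr0 mulrAC.
pose K := [set x : 'rV[R]_N | sqnorm (x - z) <= c].
(* The lower bound [-1] is vacuous. *)
apply: (@ball_comparison R N Omega K [set x | -1 < sqnorm (x - z) < c]) => //.
- by apply: continuous_subspaceW cu => x Kx; apply: subset_closure; exact: inO.
- exact: compact_eucl_ball.
- exact: open_eucl_annulus.
- by move=> x /andP[_ /ltW].
- by move=> x /andP[_ /ltW]; exact: inO.
- move=> x Kx nDx; apply: le_trans (ltW (upos _ (inO _ Kx))).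
  rewrite /ball_barrier mul0r addr0 pmulr_rle0// subr_le0 leNgt.
  apply/negP => xc; apply: nDx; rewrite /= xc andbT.
  by rewrite (lt_le_trans _ (sqnorm_ge0 _)).
- move=> x /andP[_ xc] ub.
  apply: le_lt_trans (lap _ (ltW xc)) _.
  rewrite sum_ball_barrier2 !mulr0 !mul0r addr0 mulr1 sub0r.
  have : alpha * u x < alpha * (A * c).
    rewrite ltr_pM2l// (lt_le_trans ub)// /ball_barrier mul0r addr0 ler_pM2l//.
    by rewrite gerDl oppr_le0 sqnorm_ge0.
  rewrite mulrA AE; lra.
- by rewrite /K/= subrr /sqnorm big1 ?(ltW c0)// => i _; rewrite mxE expr0n.
Qed.

(* The shift [t] keeps the argument of [W], singular at [0], positive up to the boundary. *)
Lemma barrier_upper_bound (R : realType) (N : nat) (Omega : set 'rV[R]_N)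
    (v : 'rV[R]_N -> R) (i0 : 'I_N) (M D0 E s : R) (W W1 W2 : R -> R) :
  open Omega -> compact (closure Omega) ->
  Ck_on 2 Omega v -> {within closure Omega, continuous v} ->
  0 < s -> 0 < E ->
  (forall x, Omega x -> 0 < v x) ->
  (forall x, closure Omega x -> ~ Omega x -> v x <= 0) ->
  (forall x, Omega x -> - (E / v x `^ s) < laplacian v x) ->
  (forall x, closure Omega x -> 0 <= M - x ord0 i0 <= D0) ->
  (forall y : R, 0 < y -> y <= 2 * D0 ->
    [/\ is_derive y (1 : R) W (W1 y), is_derive y (1 : R) W1 (W2 y),
        0 < W y & W2 y <= - (E / W y `^ s)]) ->
  forall t, 0 < t -> t <= D0 -> forall x, closure Omega x ->
    v x <= W (M + t - x ord0 i0).
Proof.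
move=> oO cO vC2 cv s0 E0 vpos vb vlap MD HW t t0 tD x Ox; rewrite -subr_le0.
have range z : closure Omega z ->
    0 < M + t - z ord0 i0 /\ M + t - z ord0 i0 <= 2 * D0.
  by move=> /MD/andP[? ?]; split; lra.
have ocl : Omega `<=` closure Omega by exact: subset_closure.
pose w (z : 'rV[R]_N) := W (M + t - z ord0 i0).
pose w1 (i : 'I_N) (z : 'rV[R]_N) := - (i == i0)%:R * W1 (M + t - z ord0 i0).
pose w2 (i : 'I_N) (z : 'rV[R]_N) := (i == i0)%:R * W2 (M + t - z ord0 i0).
apply: (@max_principle R N (closure Omega) Omega (v - w)
  (fun i => 'D_'e_i v - w1 i) (fun i => 'D_'e_i ('D_'e_i v) - w2 i)) => //.
- apply: within_continuousB => //.
  apply: continuous_in_subspaceT => z; rewrite inE => /range[z0 z1].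
  have [[/derivable1_diffP/differentiable_continuous dW _] _ _ _] := HW _ z0 z1.
  apply: (@continuous_comp _ _ _ (fun z : 'rV[R]_N => M + t - z ord0 i0) W) => //.
  apply: differentiable_continuous; apply: differentiableB.
    exact: differentiable_cst.
  exact: differentiable_coord.
- move=> z Oz nOz; rewrite subr_le0.
  apply: le_trans (vb _ Oz nOz) _.
  by have [z0 z1] := range _ Oz; have [_ _ /ltW] := HW _ z0 z1.
- move=> i z Oz; have [d1 _] := Ck_on_is_derive2 i i vC2 Oz.
  have [z0 z1] := range _ (ocl _ Oz); have [dW _ _ _] := HW _ z0 z1.
  by apply: is_deriveB; exact: is_derive_comp_coord.
- move=> i z Oz; have [_ d2] := Ck_on_is_derive2 i i vC2 Oz.
  have [z0 z1] := range _ (ocl _ Oz); have [_ dW _ _] := HW _ z0 z1.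
  apply: is_deriveB.
  have H := is_derive_comp_coord i dW.
  have -> : w1 i = (- (i == i0)%:R) \*: (fun z : 'rV[R]_N => W1 (M + t - z ord0 i0)).
    by [].
  apply: is_derive_eq; rewrite /w2 /GRing.scale/= mulrA mulrNN.
  by case: eqP => _; rewrite ?mulr1 ?mulr0.
- move=> z Oz; rewrite subr_gt0 => wv.
  have [z0 z1] := range _ (ocl _ Oz); have [_ _ W0 WE] := HW _ z0 z1.
  rewrite big_split/= sumrN subr_gt0.
  have -> : \sum_i w2 i z = W2 (M + t - z ord0 i0).
    rewrite (bigD1 i0)//= /w2 eqxx mul1r big1 ?addr0// => i /negPf->.
    by rewrite mul0r.
  (* Where [W < v], [s > 0] gives [E / v^s <= E / W^s], hence [W'' <= - E / W^s <= - E / v^s], which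
     is less than the Laplacian of [v]. *)
  apply: le_lt_trans (vlap _ Oz); apply: le_trans WE _.
  rewrite lerN2 ler_pM2l// lef_pV2 ?posrE ?powR_gt0 ?vpos//.
  by apply: ge0_ler_powR; rewrite ?nnegrE ?(ltW s0) ?(ltW W0)// ltW// vpos.
Qed.

(** The first two cases on the exponents use the power barrier, the third the corrected linear one.
    Evaluating at twice the distance [M - x_i] costs the factor [2^(p + 2)]. *)
Lemma power_upper_bound (R : realType) (N : nat) (Omega : set 'rV[R]_N)
    (v : 'rV[R]_N -> R) (i0 : 'I_N) (M E p q s : R) :
  open Omega -> compact (closure Omega) -> Omega !=set0 ->
  Ck_on 2 Omega v -> {within closure Omega, continuous v} ->
  0 < p -> 0 < q -> 0 < s -> 0 < E ->
  [\/ 1 < s /\ (s + 1) * (p + 2) <= 2 * q,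
      s = 1 /\ p + 2 < q
    | 0 < s < 1 /\ p + 2 <= q] ->
  (forall x, Omega x -> 0 < v x) ->
  (forall x, closure Omega x -> ~ Omega x -> v x <= 0) ->
  (forall x, Omega x -> - (E / v x `^ s) < laplacian v x) ->
  (forall x, closure Omega x -> x ord0 i0 <= M) ->
  (forall x, Omega x -> x ord0 i0 < M) ->
  exists2 C : R, 0 < C &
    forall x, Omega x -> v x `^ q <= C * (M - x ord0 i0) `^ (p + 2).
Proof.
move=> oO cO [w Ow] vC2 cv p0 q0 s0 E0 hcond vpos vb vlap clM OM.
have ocl : Omega `<=` closure Omega by exact: subset_closure.
have [c cc cmin] : exists2 c, c \in closure Omega & forall t, t \in closure Omega ->
    (c ord0 i0 : R) <= t ord0 i0.
  apply: (@EVT_min_rV _ _ (fun z : 'rV[R]_N => z ord0 i0)) => //.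
    by exists w; exact: ocl.
  by apply: continuous_subspaceT; exact: coord_continuous.
(* The [+ 1] secures the lower bound [1] that the barriers require of their interval length. *)
pose D0 := M - c ord0 i0 + 1.
have MD x : closure Omega x -> 0 <= M - x ord0 i0 <= D0.
  move=> Ox; rewrite subr_ge0 clM//= /D0.
  by have := cmin x; rewrite inE => /(_ Ox); lra.
have D01 : 1 <= D0 by rewrite /D0 lerDr subr_ge0 clM// -inE.
have D1 : 1 <= 2 * D0 by lra.
have [W [W1 [W2 [C [C0 HW]]]]] : exists (W W1 W2 : R -> R) (C : R), 0 < C /\
    forall y : R, 0 < y -> y <= 2 * D0 ->
      [/\ is_derive y (1 : R) W (W1 y), is_derive y (1 : R) W1 (W2 y),
          0 < W y, W2 y <= - (E / W y `^ s)
        & W y `^ q <= C * y `^ (p + 2)].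
  case: hcond => [[s1 h]|[s1 h]|[/andP[_ s1] h]].
  - apply: sublinear_barrier => //; last by lra.
    nra.
  - by apply: sublinear_barrier => //; rewrite s1; lra.
  - exact: linear_barrier.
exists (C * 2 `^ (p + 2)); first by rewrite mulr_gt0// powR_gt0.
move=> x Ox; have Mx : 0 < M - x ord0 i0 by rewrite subr_gt0 OM.
have MxD : M - x ord0 i0 <= D0 by have /andP[] := MD _ (ocl _ Ox).
have y0 : 0 < 2 * (M - x ord0 i0) by rewrite mulr_gt0.
have y1 : 2 * (M - x ord0 i0) <= 2 * D0 by rewrite ler_pM2l.
have [_ _ Wpos _ WC] := HW _ y0 y1.
have HW' (y : R) : 0 < y -> y <= 2 * D0 ->
    [/\ is_derive y (1 : R) W (W1 y), is_derive y (1 : R) W1 (W2 y),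
        0 < W y & W2 y <= - (E / W y `^ s)].
  by move=> a b; have [? ? ? ? _] := HW _ a b.
(* Apply the bound at [x] with the shift [t := M - x_i], which depends on [x]. *)
have := barrier_upper_bound oO cO vC2 cv s0 E0 vpos vb vlap MD HW' Mx MxD (ocl _ Ox).
have -> : M + (M - x ord0 i0) - x ord0 i0 = 2 * (M - x ord0 i0) by ring.
move=> vW; rewrite -mulrA -powRM ?(ltW Mx)//.
apply: le_trans WC; apply: ge0_ler_powR => //; rewrite ?nnegrE.
- exact: ltW.
- by apply: ltW; exact: vpos.
- exact: ltW.
Qed.

(** * Geometry along the normal and the final contradiction *)

(** For [d = x - (x0 - t m)] the vector on the left is [x - (x0 - m)]. Thus the ball of radius
    [t |m| / 4] about [x0 - t m] sits inside the tangent ball, at a depth proportional to [t]. *)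
Lemma sqnorm_shift_le (R : realType) (N : nat) (d m : 'rV[R]_N) (t : R) :
  0 < t -> t <= 1 -> sqnorm d <= sqnorm m * t ^+ 2 / 16 ->
  sqnorm (d + (1 - t) *: m) <= sqnorm m - sqnorm m * t / 2.
Proof.
move=> t0 t1 dm.
(* Young's inequality for the cross term, weighted so that [|d|^2 <= t^2 |m|^2 / 16] balances both
   parts. *)
have H : sqnorm (d + (1 - t) *: m) <= (1 + 4 * (1 - t) / t) * sqnorm d +
    ((1 - t) ^+ 2 + (1 - t) * t / 4) * sqnorm m.
  rewrite /sqnorm !mulr_sumr -big_split/=; apply: ler_sum => i _; rewrite !mxE.
  set a := d ord0 i; set b := m ord0 i; rewrite -subr_ge0.
  have -> : (1 + 4 * (1 - t) / t) * a ^+ 2 + ((1 - t) ^+ 2 + (1 - t) * t / 4) * b ^+ 2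
      - (a + (1 - t) * b) ^+ 2 = (1 - t) * (4 * a - t * b) ^+ 2 / (4 * t).
    by field; rewrite gt_eqF.
  apply: divr_ge0; last by rewrite mulr_ge0// ltW.
  by rewrite mulr_ge0 ?sqr_ge0// subr_ge0.
apply: le_trans H _.
have q0 : 0 <= 1 + 4 * (1 - t) / t.
  apply: addr_ge0 => //; apply: divr_ge0; last exact: ltW.
  by rewrite mulr_ge0// subr_ge0.
have := ler_wpM2l q0 dm.
have -> : (1 + 4 * (1 - t) / t) * (sqnorm m * t ^+ 2 / 16) =
    sqnorm m * (t ^+ 2 / 16 + (1 - t) * t / 4).
  by field; rewrite gt_eqF.
have m0 := sqnorm_ge0 m.
have : 0 <= sqnorm m * (t * (16 - 9 * t)).
  by apply: mulr_ge0 => //; apply: mulr_ge0; [exact: ltW|lra].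
lra.
Qed.

(** A point of an open set can be pushed a little along ['e_i] without leaving it. *)
Lemma open_lt_coord_max (R : realType) (N : nat) (Omega : set 'rV[R]_N)
    (i : 'I_N) (M : R) :
  open Omega -> (forall x, Omega x -> x ord0 i <= M) ->
  forall x, Omega x -> x ord0 i < M.
Proof.
move=> oO OM x Ox.
have [d d0 dO] := nbhs_box (open_nbhs_nbhs (conj oO Ox)).
have := OM (x + (d / 2) *: 'e_i); rewrite !mxE !eqxx mulr1.
have d2 : 0 < d / 2 by rewrite divr_gt0.
move=> H; apply: lt_le_trans (H _); first by rewrite ltrDl.
apply: dO => j; rewrite !mxE eqxx/= addrAC subrr add0r.
case: (j == i); rewrite ?mulr0 ?normr0// mulr1 gtr0_norm//; lra.
Qed.

Unset Implicit Arguments.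

Theorem corollary2p2 (R : realType) (N : nat) (hN : (1 <= N)%N)
    (Omega : set 'rV[R]_N)
    (hOmega : bounded_domain Omega) (hbd : smooth_boundary Omega)
    (alpha beta : R) (halpha : 0 < alpha) (hbeta : 0 < beta)
    (gamma : R) (hgamma0 : 0 < gamma) (hgamma1 : gamma < 1)
    (rho : 'rV[R]_N -> R) (hrho : holder_on gamma Omega rho)
    (hrho_ge0 : forall x, Omega x -> 0 <= rho x)
    (hrho_neq0 : exists2 x, Omega x & rho x != 0)
    (p q r s : R) (hp : 0 < p) (hq : 0 < q) (hr : 0 < r) (hs : 0 < s)
    (hcond : [\/ 1 < s /\ (s + 1) * (p + 2) <= 2 * q,
                 s = 1 /\ p + 2 < q
               | 0 < s < 1 /\ p + 2 <= q]) :
  ~ exists u v : 'rV[R]_N -> R,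
      positive_classical_solution Omega alpha beta p q r s rho u v.
Proof.
move=> [u [v [[uC2 cu vC2 cv] pos equ eqv bd]]].
have [oO _ [w Ow] bO] := hOmega.
have cO := compact_closure_bounded bO.
have ocl : Omega `<=` closure Omega by exact: subset_closure.
have bd0 x : closure Omega x -> ~ Omega x -> u x = 0 /\ v x = 0.
  by move=> clx nOx; apply: bd; split => // /interior_subset.
pose i0 := Ordinal hN.
have [x0 clx0 x0max] : exists2 c, c \in closure Omega &
    forall t, t \in closure Omega -> (t ord0 i0 : R) <= c ord0 i0.
  apply: (@EVT_max_rV _ _ (fun z : 'rV[R]_N => z ord0 i0)) => //.
    by exists w; exact: ocl.
  by apply: continuous_subspaceT; exact: coord_continuous.
rewrite inE in clx0.
have clM x : closure Omega x -> x ord0 i0 <= x0 ord0 i0.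
  by move=> clx; apply: x0max; rewrite inE.
have OM := open_lt_coord_max oO (fun x Ox => clM x (ocl x Ox)).
have nOx0 : ~ Omega x0 by move=> /OM; rewrite ltxx.
have [ux0 vx0] := bd0 _ clx0 nOx0.
have [cm cmcl cmmax] : exists2 c, c \in closure Omega &
    forall t, t \in closure Omega -> u t <= u c.
  by apply: EVT_max_rV => //; exists w; exact: ocl.
have umax x : Omega x -> u x <= u cm.
  by move=> Ox; apply: cmmax; rewrite inE; exact: ocl.
have ucm : 0 < u cm by apply: lt_le_trans (umax _ Ow); have [] := pos _ Ow.
have upos x : Omega x -> 0 < u x by move=> /pos[].
have vpos x : Omega x -> 0 < v x by move=> /pos[].
pose E := u cm `^ r.
have E0 : 0 < E by exact: powR_gt0.
(* Strictness comes from the positive term [beta * v x]. *)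
have vlap x : Omega x -> - (E / v x `^ s) < laplacian v x.
  move=> Ox; have := eqv _ Ox.
  have bv : 0 < beta * v x by rewrite mulr_gt0 ?vpos.
  have : u x `^ r / v x `^ s <= E / v x `^ s.
    rewrite ler_wpM2r ?invr_ge0 ?powR_ge0//.
    apply: ge0_ler_powR; rewrite ?nnegrE.
    - exact: ltW.
    - exact/ltW/upos.
    - exact: ltW.
    - exact: umax.
  lra.
have [C C0 vC] : exists2 C : R, 0 < C & forall x, Omega x ->
    v x `^ q <= C * (x0 ord0 i0 - x ord0 i0) `^ (p + 2).
  apply: (@power_upper_bound R N Omega v i0 (x0 ord0 i0) E p q s) => //.
    by exists w.
  by move=> x clx nOx; have [_ ->] := bd0 _ clx nOx.
have [m m0 inO] : exists2 m : 'rV[R]_N, 0 < sqnorm m &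
    forall x, x != x0 -> sqnorm (x - (x0 - m)) <= sqnorm m -> Omega x.
  have [|U [phi [[oU Ux0] sphi dphi Uphi]]] := hbd x0.
    by split => // /interior_subset.
  apply: (interior_ball oU Ux0 (sphi 2%N) dphi); last first.
    by move=> x Ux; have [_] := Uphi _ Ux.
  (* [phi x0 < 0] would put [x0] in [Omega]; [phi x0 > 0] would keep a whole neighbourhood of [x0]
     out of [Omega], against [x0] being in its closure. *)
  apply/eqP; rewrite eq_le; apply/andP; split; last first.
    by rewrite leNgt; apply/negP => phi0; apply: nOx0; apply/(Uphi _ Ux0).
  rewrite leNgt; apply/negP => phi0.
  have cphi : {for x0, continuous phi}.
    by have [c _] := sphi 1%N; apply: c; rewrite inE.
  have near_pos : \forall z \near x0, 0 < phi z.
    by apply: (cphi [set y : R | 0 < y]); apply: open_nbhs_nbhs; split; [exact: open_gt|].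
  have [z [Oz [Uz pz]]] := clx0 _ (filterI (open_nbhs_nbhs (conj oU Ux0)) near_pos).
  by have := (Uphi _ Uz).1 Oz; rewrite ltNge (ltW pz).
set r2 := sqnorm m in m0 inO.
have [e e0 hopf] : exists2 e : R, 0 < e & forall x, sqnorm (x - (x0 - m)) <= r2 ->
    e * (r2 - sqnorm (x - (x0 - m))) <= u x.
  apply: (@hopf_lower_bound R N Omega u alpha r2 x0 (x0 - m)) => //.
  - by rewrite ux0.
  - by rewrite opprB addrC subrK.
  - move=> x Ox; have := equ _ Ox; have := hrho_ge0 _ Ox.
    have : 0 <= u x `^ p / v x `^ q by rewrite divr_ge0 ?powR_ge0.
    lra.
(* [B^2 >= r2], so [B] bounds the length of [m]. *)
pose B := 1 + r2.
have B0 : 0 < B by rewrite /B; lra.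
have mB j : `|m ord0 j| <= B.
  rewrite -ler_sqr ?nnegrE ?(ltW B0)// real_normK ?num_real//.
  apply: le_trans (ler_sqnorm m j) _; rewrite -/r2 /B; nra.
(* Numerator from [u >= (e r2 / 2) t], denominator from [v^q <= C (2 B t)^(p + 2)]; the powers of
   [t] leave [u^p / v^q >= c3 / t^2]. *)
pose c3 := (e * r2 / 2) `^ p / (C * (2 * B) `^ (p + 2)).
have c30 : 0 < c3.
  apply: divr_gt0; first by rewrite powR_gt0// divr_gt0// mulr_gt0.
  by rewrite mulr_gt0// powR_gt0// mulr_gt0.
have kappa0 : 0 < r2 / 16 by rewrite divr_gt0.
(* The interior bound with [g = c3 / t^2] and [c = r2 t^2 / 16]: the product [g c] is free of [t],
   and [c] in the denominator is replaced by its largest value, at [t = 1]. *)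
pose delta := c3 * (r2 / 16) / (alpha * (r2 / 16) + 2 * N%:R).
have lower (t : R) : 0 < t -> t <= 1 -> Omega (x0 - t *: m) /\ delta <= u (x0 - t *: m).
  move=> t0 t1; set z := x0 - t *: m; pose c := r2 * t ^+ 2 / 16.
  have c0 : 0 < c by rewrite /c divr_gt0// mulr_gt0// exprn_gt0.
  have near_ball x : sqnorm (x - z) <= c ->
      sqnorm (x - (x0 - m)) <= r2 - r2 * t / 2.
    move=> xz; have := sqnorm_shift_le t0 t1 xz.
    suff -> : x - z + (1 - t) *: m = x - (x0 - m) by [].
    by apply/rowP => j; rewrite !mxE; ring.
  have rt : 0 < r2 * t / 2 by rewrite divr_gt0// mulr_gt0.
  have cO' x : sqnorm (x - z) <= c -> Omega x.
    move=> /near_ball xz; apply: inO; last by apply: le_trans xz _; lra.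
    (* The point [x0] lies on the tangent sphere, hence outside the smaller ball. *)
    apply/eqP => xx0; move: xz; rewrite xx0 opprB addrC subrK -/r2; lra.
  split.
    by apply: cO'; rewrite subrr /sqnorm big1 ?(ltW c0)// => i _; rewrite mxE expr0n.
  have lapu x : sqnorm (x - z) <= c -> laplacian u x <= alpha * u x - c3 / t ^+ 2.
    move=> xz; have Ox := cO' _ xz; have xb := near_ball _ xz.
    have := equ _ Ox; have := hrho_ge0 _ Ox.
    suff : c3 / t ^+ 2 <= u x `^ p / v x `^ q by lra.
    have ux : e * r2 / 2 * t <= u x.
      apply: le_trans (hopf x _); last by apply: le_trans xb _; lra.
      have -> : e * r2 / 2 * t = e * (r2 * t / 2) by ring.
      by rewrite ler_pM2l//; lra.
    have up : (e * r2 / 2) `^ p * t `^ p <= u x `^ p.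
      have er0 : 0 <= e * r2 / 2 by rewrite divr_ge0// mulr_ge0// ltW.
      rewrite -powRM ?(ltW t0)//.
      apply: ge0_ler_powR; rewrite ?nnegrE //.
      - exact: ltW.
      - by rewrite mulr_ge0// ltW.
      - exact/ltW/upos.
    (* One [B t] accounts for the displacement [t m] of the centre, the other for the radius of the
       small ball. *)
    have xt : x0 ord0 i0 - x ord0 i0 <= 2 * B * t.
      have -> : x0 ord0 i0 - x ord0 i0 = t * m ord0 i0 - (x - z) ord0 i0.
        by rewrite /z !mxE; ring.
      have h1 : t * m ord0 i0 <= t * B.
        by rewrite ler_pM2l// (le_trans (ler_norm _)).
      have h2 : - (x - z) ord0 i0 <= t * B.
        rewrite (le_trans (ler_norm _))// normrN -ler_sqr ?nnegrE//; last first.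
          by rewrite mulr_ge0// ltW.
        rewrite real_normK ?num_real//.
        apply: le_trans (ler_sqnorm _ _) _; apply: le_trans xz _.
        rewrite /c exprMn [r2 * _]mulrC -mulrA ler_pM2l ?exprn_gt0// /B; nra.
      lra.
    have vq : v x `^ q <= C * (2 * B) `^ (p + 2) * (t `^ p * t ^+ 2).
      apply: le_trans (vC _ Ox) _; rewrite -mulrA ler_pM2l//.
      rewrite -powR_mulrn ?(ltW t0)// -powRD; last by rewrite (gt_eqF t0) implybT.
      rewrite -powRM ?(ltW t0)//; last by rewrite mulr_ge0// ltW.
      apply: ge0_ler_powR => //; rewrite ?nnegrE.
      - by rewrite addr_ge0// ltW.
      - by rewrite subr_ge0 ltW// OM.
      - by rewrite mulr_ge0 ?(ltW t0)// mulr_ge0// ltW.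
    have tp0 : 0 < t `^ p by exact: powR_gt0.
    have vq0 : 0 < v x `^ q by rewrite powR_gt0// vpos.
    have D0 : 0 < C * (2 * B) `^ (p + 2) by rewrite mulr_gt0// powR_gt0// mulr_gt0.
    apply: (@le_trans _ _ ((e * r2 / 2) `^ p * t `^ p / v x `^ q)); last first.
      by rewrite ler_wpM2r// invr_ge0 ltW.
    rewrite ler_pdivlMr//.
    apply: (@le_trans _ _ (c3 / t ^+ 2 * (C * (2 * B) `^ (p + 2) * (t `^ p * t ^+ 2)))).
      by rewrite ler_wpM2l// divr_ge0 ?sqr_ge0// ltW.
    rewrite le_eqVlt; apply/orP; left; apply/eqP.
    by rewrite /c3; field; rewrite !gt_eqF ?powR_gt0 ?mulr_gt0.
  have g0 : 0 < c3 / t ^+ 2 by rewrite divr_gt0// exprn_gt0.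
  apply: le_trans (interior_lower_bound uC2 cu halpha c0 g0 cO' upos lapu).
  have -> : c3 / t ^+ 2 * c = c3 * (r2 / 16).
    by rewrite /c; field; rewrite gt_eqF.
  have N0 : 0 <= 2 * N%:R :> R by rewrite mulr_ge0.
  have ac : 0 < alpha * c by rewrite mulr_gt0.
  have ar : 0 < alpha * (r2 / 16) by rewrite mulr_gt0.
  apply: ler_wpM2l; first by rewrite mulr_ge0 ?(ltW c30) ?(ltW kappa0).
  rewrite lef_pV2 ?posrE ?ltr_pwDl// lerD2r ler_pM2l// /c.
  rewrite mulrAC ler_piMr ?(ltW kappa0)//; nra.
have delta0 : 0 < delta.
  apply: divr_gt0; first exact: mulr_gt0.
  by apply: ltr_pwDl; [exact: mulr_gt0|exact: mulr_ge0].
have near0 : within (closure Omega) (nbhs x0) [set z | `|u x0 - u z| < delta].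
  rewrite nbhs_subspace_in//.
  by have /cvgrPdist_lt/(_ _ delta0) := cu x0.
have [d d0 dU] := nbhs_box near0.
(* Then [t |m_j| <= d / 2], so [x0 - t m] enters the box where continuity forces [u < delta]. *)
pose t := Num.min 1 (d / (2 * B)).
have t0 : 0 < t by rewrite lt_min ltr01 divr_gt0// mulr_gt0.
have t1 : t <= 1 by rewrite ge_min lexx.
have td : t <= d / (2 * B) by rewrite ge_min lexx orbT.
have [Oz zd] := lower _ t0 t1.
have := dU (x0 - t *: m) _ (ocl _ Oz).
rewrite /= ux0 sub0r normrN => H.
suff : `|u (x0 - t *: m)| < delta by rewrite gtr0_norm ?upos// ltNge zd.
apply: H => j; rewrite !mxE addrAC subrr add0r normrN normrM gtr0_norm//.
apply: (@le_lt_trans _ _ (d / 2)); last by lra.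
apply: le_trans (ler_pM (ltW t0) (normr_ge0 _) td (mB j)) _.
by rewrite le_eqVlt; apply/orP; left; apply/eqP; field; rewrite gt_eqF.
Qed.
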